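(* A minimal abelian reflexive nonsemicommutative ring has order $256$, an example of which is the group ring $\mathbb{F}_2D_8$. That is: every ring that is abelian, reflexive and not semicommutative has at least $256$ elements, and $\mathbb{F}_2D_8$ is an abelian, reflexive, nonsemicommutative ring of order $256$.
   Context: All rings are associative with identity $1\neq 0$, not necessarily commutative. A ring $R$ is abelian if each idempotent of $R$ is central. A ring $R$ is reflexive if for all $a,b\in R$, $aRb=0$ implies $bRa=0$. A ring $R$ is semicommutative if for all $a,b\in R$, $ab=0$ implies $aRb=0$; nonsemicommutative means not semicommutative. A minimal ring of a given type is a ring of that type of smallest possible cardinality. $D_8=\langle r,s\mid r^4=s^2=(sr)^2=1\rangle$ is the dihedral group with $8$ elements and $\mathbb{F}_2D_8$ is its group algebra over the field $\mathbb{F}_2$ with two elements. *)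

(* Defs.v *)
From HB Require Import structures.
From mathcomp Require Import all_boot all_order all_fingroup all_algebra.
From mathcomp Require Import all_solvable.

Set Implicit Arguments.
Unset Strict Implicit.
Unset Printing Implicit Defensive.

Import GRing.Theory.
Local Open Scope ring_scope.

Section RingProperties.
Variable R : nzRingType.

Definition abelian_ring : Prop :=
  forall e : R, e * e = e -> forall x : R, e * x = x * e.

Definition reflexive_ring : Prop :=
  forall a b : R,
    (forall r : R, a * r * b = 0) -> (forall r : R, b * r * a = 0).

Definition semicommutative_ring : Prop :=
  forall a b : R, a * b = 0 -> forall r : R, a * r * b = 0.

End RingProperties.

(* The group ring R[G] of a finite group, G being all of gT: the function f   *)
(* stands for the formal sum of the f x *: x. This is a separate constant     *)
(* because the product is convolution, not the pointwise product of {ffun _}. *)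
Definition groupRing (R : nzRingType) (gT : finGroupType) : Type :=
  {ffun gT -> R}.

Section GroupRing.
Variables (R : nzRingType) (gT : finGroupType).
Local Notation RG := (groupRing R gT).

HB.instance Definition _ := GRing.Zmodule.on RG.

Definition groupRing_one : RG := [ffun x : gT => (x == 1%g)%:R].

Definition groupRing_mul (f g : RG) : RG :=
  [ffun x : gT => \sum_(y : gT) f y * g (y^-1 * x)%g].

Fact groupRing_mulA : associative groupRing_mul.
Proof.
move=> f g h; apply/ffunP=> x; rewrite !ffunE.
under eq_bigr => y _ do rewrite ffunE mulr_sumr.
under [RHS]eq_bigr => z _ do rewrite ffunE mulr_suml.
rewrite [RHS]exchange_big /=; apply: eq_bigr => y _.
rewrite [RHS](reindex_inj (mulgI y)) /=; apply: eq_bigr => z _.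
by rewrite mulKg invMg mulrA !mulgA.
Qed.

Fact groupRing_mul1f : left_id groupRing_one groupRing_mul.
Proof.
move=> f; apply/ffunP=> x; rewrite ffunE (bigD1 1%g) //= big1 => [|y ny1].
  by rewrite ffunE eqxx mul1r invg1 mul1g addr0.
by rewrite ffunE (negPf ny1) mul0r.
Qed.

Fact groupRing_mulf1 : right_id groupRing_one groupRing_mul.
Proof.
move=> f; apply/ffunP=> x; rewrite ffunE (bigD1 x) //= big1 => [|y nyx].
  by rewrite ffunE mulVg eqxx mulr1 addr0.
by rewrite ffunE -eq_mulVg1 (negPf nyx) mulr0.
Qed.

Fact groupRing_mulDl : left_distributive groupRing_mul +%R.
Proof.
move=> f g h; apply/ffunP=> x; rewrite !ffunE -big_split /=.
by apply: eq_bigr => y _; rewrite ffunE mulrDl.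
Qed.

Fact groupRing_mulDr : right_distributive groupRing_mul +%R.
Proof.
move=> f g h; apply/ffunP=> x; rewrite !ffunE -big_split /=.
by apply: eq_bigr => y _; rewrite ffunE mulrDr.
Qed.

Fact groupRing_one_neq0 : groupRing_one != 0.
Proof.
apply/eqP => /ffunP /(_ 1%g); rewrite !ffunE eqxx => /eqP.
by rewrite oner_eq0.
Qed.

HB.instance Definition _ := GRing.Zmodule_isNzRing.Build RG
  groupRing_mulA groupRing_mul1f groupRing_mulf1
  groupRing_mulDl groupRing_mulDr groupRing_one_neq0.

End GroupRing.

HB.instance Definition _ (R : finNzRingType) (gT : finGroupType) :=
  Finite.on (groupRing R gT).

(* 'D_8 is constructed as a semidirect product; this is its presentation.     *)
Fact D8_presentation :
  ('D_8 \isog Grp (r : s : r ^+ 4, s ^+ 2, (s * r) ^+ 2))%g.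
Proof.
move=> gT G; rewrite (@Grp_dihedral 4) //.
apply: eq_existsb => -[x y] /=; rewrite !xpair_eqE.
congr (_ && _); congr (_ && _); case: eqP => //= y2.
have yV : y^-1%g = y by apply/eqP; rewrite eq_invg_mul -(expgS y 1) y2.
by rewrite conjgE yV eq_mulgV1 invgK expgS expg1 !mulgA.
Qed.

(* Main.v *)
Require Import Defs.
From HB Require Import structures.
From mathcomp Require Import all_boot all_order all_fingroup all_algebra.
From mathcomp Require Import all_solvable.
From Stdlib Require Import Classical.

Set Implicit Arguments.
Unset Strict Implicit.
Unset Printing Implicit Defensive.

Import GRing.Theory.
Local Open Scope ring_scope.

(** Lower bound. Let [R] be abelian and reflexive with fewer than 256 elements, and
    suppose that [a * b = 0] but [a * r * b <> 0]. Idempotents being central,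
    [e R] is a ring for each of them; a minimal idempotent [e] with
    [e * (a * r * b) <> 0] gives a reflexive corner ring with the same defect and
    without idempotents besides 0 and 1 ([abelian_reflexive_order]). In such a
    ring of bounded size every element is nilpotent or invertible, because some
    power of it is idempotent; so the ring is local and its radical [J] is
    nilpotent ([nilpotent_local_radical], [nilpotent_radical_pow]).

    Let [q] be the order of the residue field and [d_i] the dimension of
    [J^i / J^(i+1)]. The ring has at least [q^(1 + d_1 + d_2 + ...)] elements
    ([at_least_pow]). If [d_1 <= 1], it is a chain ring and semicommutative
    ([semicommutative_dim1]); if [J^2 = 0], it is semicommutative as well. This
    leaves [q <= 3], a prime field, so that every element is central modulo [J]
    and [r] may be taken in [J]; in particular [J^3 <> 0]. Now reflexivity is
    used in the form [reflexive_from_radical]: if [x * y = 0] and [x J y = 0],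
    then [y R x = 0]. When the powers of [J] vanish early, the condition
    [x J y = 0] is often automatic, and relations between products can be
    rotated. This settles the remaining dimensions:
    [semicommutative_dim2] covers [d_1 = 2] with [J^4 = 0],
    [semicommutative_square_dim1] covers [d_2 = 1],
    [semicommutative_cube_dim1] covers (3, 2, 1), and
    [semicommutative_dims_2211] covers (2, 2, 1, 1).

    Example. A group ring over a commutative ring is reflexive because the
    coefficient at the identity is a symmetric nondegenerate trace form
    ([groupRing_reflexive]). Over the field with [p] elements, the group ring of a
    [p]-group has only the idempotents 0 and 1, by counting fixed points
    ([groupRing_pgroup_idempotents]). Finally, an involution [s] that does not
    commute with [t] gives [(1 - s) * (1 + s) = 0] and
    [(1 - s) * t * (1 + s) <> 0] ([groupRing_nonsemicommutative]); the dihedral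
    group of order 8 contains such [s] and [t]. *)

(** * Left ideals, independence and counting *)

Section LeftIdeals.
Variable R : nzRingType.
Implicit Types A P : R -> Prop.

Definition left_ideal A : Prop :=
  [/\ A 0, forall x y, A x -> A y -> A (x + y) & forall r x, A x -> A (r * x)].

Lemma left_idealN A x : left_ideal A -> A x -> A (- x).
Proof. by case=> _ _ AM Ax; rewrite -mulN1r; apply: AM. Qed.

Lemma left_idealB A x y : left_ideal A -> A x -> A y -> A (x - y).
Proof.
by move=> lA Ax Ay; case: (lA) => _ AD _; apply: AD (left_idealN lA Ay).
Qed.

Inductive additive_span A : R -> Prop :=
| span_gen x : A x -> additive_span A x
| span_add x y : additive_span A x -> additive_span A y ->
    additive_span A (x + y).

(** The left ideal generated by [A] and [t]. *)
Definition adjoin A (t z : R) : Prop := exists r, A (z - r * t).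

Lemma left_ideal_adjoin A t : left_ideal A -> left_ideal (adjoin A t).
Proof.
move=> [A0 AD AM]; split=> [|x y [r Ar] [s As]|s x [r Ar]].
- by exists 0; rewrite mul0r subr0.
- by exists (r + s); rewrite mulrDl opprD addrACA; apply: AD.
by exists (s * r); rewrite -mulrA -mulrBr; apply: AM.
Qed.

Lemma sub_adjoin A t z : A z -> adjoin A t z.
Proof. by move=> Az; exists 0; rewrite mul0r subr0. Qed.

(** When [A] is [J^(i+1)] and the terms lie in [J^i], where [J] is the radical
    of a local ring, this is linear independence modulo [A] over the residue
    field. *)
Fixpoint independent A (ts : seq R) : Prop :=
  if ts is t :: ts' then ~ A t /\ independent (adjoin A t) ts' else True.

Definition at_least A (n : nat) : Prop :=
  exists s : seq R, [/\ uniq s, size s = n & forall x, x \in s -> A x].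

Lemma sub_at_least A P n :
  (forall x, A x -> P x) -> at_least A n -> at_least P n.
Proof. by move=> AP [s [us szs As]]; exists s; split=> // x /As/AP. Qed.

Lemma leq_at_least A m n : (m <= n)%N -> at_least A n -> at_least A m.
Proof.
move=> mn [s [us szs As]]; exists (take m s); split=> [||x /mem_take/As//].
  exact: take_uniq.
by rewrite size_take szs; case: ltngtP mn.
Qed.

Lemma at_least_injection A n :
  at_least A n -> exists f : 'I_n -> R, injective f.
Proof.
case=> s [us szs _]; exists (fun i => nth 0 s i) => i j /eqP.
by rewrite nth_uniq ?szs ?ltn_ord // => /eqP/val_inj.
Qed.

(** Such a [T] maps injectively to the residue field of a local ring, so its
    size is a lower bound for the order [q] of that field. Bounding [q] through
    such lists makes it unnecessary to construct the residue field. *)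
Definition unit_differences (T : seq R) : Prop :=
  uniq T /\ {in T &, forall u v, u != v -> exists y, y * (u - v) = 1}.

(** The elements [u * t + x], with [u] in [T] and [x] in [A], are distinct:
    two coinciding expressions with different [u], [v] would put
    [(u - v) * t], hence [t], in [A]. *)
Lemma at_least_adjoin A T t n : left_ideal A -> unit_differences T ->
  ~ A t -> at_least A n -> at_least (adjoin A t) (size T * n).
Proof.
move=> lA [uT dT] nAt [s [us szs As]].
exists [seq u * t + x | u <- T, x <- s]; split.
- apply: allpairs_uniq => // -[u x] [v y] /= /allpairsP[[u' x'] /= [uT' xs']].
  case=> -> -> /allpairsP[[v' y'] /= [vT ys [-> ->]]] eqxy.
  have Auv : A ((u' - v') * t).
    rewrite (_ : _ * t = y' - x'); first by apply: left_idealB; auto.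
    by apply/eqP; rewrite mulrBl subr_eq addrAC eq_sym subr_eq addrC -eqxy addrC.
  have [euv|neuv] := eqVneq u' v'.
    by move: eqxy; rewrite euv => /addrI ->.
  have [z zuv] := dT _ _ uT' vT neuv.
  by case: nAt; rewrite -[t]mul1r -zuv -mulrA; case: lA => _ _; apply.
- by rewrite size_allpairs szs.
move=> z /allpairsP[[u x] /= [_ xs ->]]; exists u.
by rewrite addrC addKr; apply: As.
Qed.

Lemma at_least_independent A T ts P n : left_ideal A -> left_ideal P ->
  unit_differences T -> (forall x, A x -> P x) -> {in ts, forall t, P t} ->
  independent A ts -> at_least A n -> at_least P (size T ^ size ts * n).
Proof.
move=> + lP dT; elim: ts A n => [|t ts IHts] A n lA AP tsP /=.
  by rewrite expn0 mul1n => _; apply: sub_at_least.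
case=> nAt ind bA; rewrite expnSr -mulnA; apply: IHts ind _.
- exact: left_ideal_adjoin.
- move=> x [r Ax]; rewrite -[x](subrK (r * t)).
  case: lP => _ PD PM; apply: PD; first exact: AP.
  by apply/PM/tsP; rewrite inE eqxx.
- by move=> x xts; apply: tsP; rewrite inE xts orbT.
exact: at_least_adjoin.
Qed.

End LeftIdeals.

(** * The filtration of a local ring by the powers of its radical *)

Record local_radical (R : nzRingType) (J : R -> Prop) : Prop := LocalRadical {
  radicalD : forall x y, J x -> J y -> J (x + y);
  radicalMl : forall r x, J x -> J (r * x);
  radicalMr : forall r x, J x -> J (x * r);
  radical1 : ~ J 1;
  radicalC : forall x, ~ J x -> exists y, y * x = 1 /\ x * y = 1 }.

Section Powers.
Variables (R : nzRingType) (J : R -> Prop).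
Hypothesis locJ : local_radical J.
Let JD := radicalD locJ.
Let JMl := radicalMl locJ.
Let JMr := radicalMr locJ.

(** The ideal [J^n]. *)
Fixpoint pow (n : nat) : R -> Prop :=
  if n is m.+1 then
    additive_span (fun z => exists x y, [/\ J x, pow m y & z = x * y])
  else fun _ => True.

Arguments pow : simpl never.

Lemma pow_prod n x y : J x -> pow n y -> pow n.+1 (x * y).
Proof. by move=> Jx py; apply: span_gen; exists x, y. Qed.

Lemma powD n x y : pow n x -> pow n y -> pow n (x + y).
Proof. by case: n => // n; apply: span_add. Qed.

Lemma powS_ind n (P : R -> Prop) :
  (forall x y, J x -> pow n y -> P (x * y)) ->
  (forall x y, P x -> P y -> P (x + y)) -> forall x, pow n.+1 x -> P x.
Proof.
by move=> PM PD x; elim=> [_ [y [z [Jy pz ->]]]|y z _ Py _ Pz]; auto.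
Qed.

Lemma radical0 : J 0.
Proof.
apply: NNPP => /(radicalC locJ)[y []].
by rewrite mulr0 => /eqP; rewrite eq_sym oner_eq0.
Qed.

Lemma radical_zero_divisors a b r :
  a * b = 0 -> a * r * b <> 0 -> J a /\ J b.
Proof.
move=> ab0 arb0; split; apply: NNPP => /(radicalC locJ)[y [yx xy]]; apply: arb0.
  by rewrite -[b]mul1r -yx -[y * a * b]mulrA ab0 !mulr0.
by rewrite -[a]mulr1 -xy (mulrA a) ab0 !mul0r.
Qed.

Lemma pow_mulr n r x : pow n x -> pow n (x * r).
Proof.
elim: n x => // n IHn; apply: powS_ind => [x y Jx py|x y px py].
  by rewrite -mulrA; apply: pow_prod; auto.
by rewrite mulrDl; apply: powD.
Qed.

Lemma pow_mull n r x : pow n x -> pow n (r * x).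
Proof.
case: n x => // n; apply: powS_ind => [x y Jx py|x y px py].
  by rewrite mulrA; apply: pow_prod; auto.
by rewrite mulrDr; apply: powD.
Qed.

Lemma pow_0 n : pow n 0.
Proof.
elim: n => // n IHn; rewrite -[0](mul0r 0).
exact: pow_prod radical0 IHn.
Qed.

Lemma left_ideal_pow n : left_ideal (pow n).
Proof. by split; [apply: pow_0|apply: powD|move=> r x; apply: pow_mull]. Qed.

Lemma powN n x : pow n x -> pow n (- x).
Proof. by move=> px; apply: left_idealN px; apply: left_ideal_pow. Qed.

Lemma powB n x y : pow n x -> pow n y -> pow n (x - y).
Proof. by move=> px py; apply: left_idealB px py; apply: left_ideal_pow. Qed.

Lemma pow_subr n x y : pow n y -> pow n (x - y) -> pow n x.
Proof. by move=> py /powD/(_ py); rewrite subrK. Qed.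

Lemma pow_subC n x y : pow n (x - y) -> pow n (y - x).
Proof. by move/powN; rewrite opprB. Qed.

Lemma pow_subl n x y : pow n x -> pow n (x - y) -> pow n y.
Proof. by move=> px /pow_subC/(pow_subr px). Qed.

Lemma powM m n x y : pow m x -> pow n y -> pow (m + n) (x * y).
Proof.
move=> + py; elim: m x => [|m IHm] x; first by move=> _; apply: pow_mull.
move: x; apply: powS_ind => [x z Jx pz|x z px pz].
  by rewrite -mulrA addSn; apply: pow_prod; auto.
by rewrite mulrDl; apply: powD.
Qed.

Lemma pow_leq m n x : (m <= n)%N -> pow n x -> pow m x.
Proof.
move=> /subnK <-; elim: (n - m)%N x => // k IHk; rewrite addSn.
apply: powS_ind => [x y _ py|]; last exact: powD.
exact/pow_mull/IHk.
Qed.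

Lemma pow1P x : pow 1 x <-> J x.
Proof.
split=> [|Jx]; last by rewrite -[x]mulr1; apply: pow_prod.
by move: x; apply: powS_ind => [x y Jx _|]; [apply: JMr|apply: JD].
Qed.

Lemma pow_exp n x : J x -> pow n (x ^+ n).
Proof. by move=> Jx; elim: n => // n IHn; rewrite exprS; apply: pow_prod. Qed.

Lemma powSr_ind n (P : R -> Prop) :
  (forall x y, pow n x -> J y -> P (x * y)) ->
  (forall x y, P x -> P y -> P (x + y)) -> forall x, pow n.+1 x -> P x.
Proof.
elim: n P => [|n IHn] P PM PD.
  by move=> x /pow1P Jx; rewrite -[x]mul1r; apply: PM.
apply: powS_ind => // x y Jx; move: y; apply: IHn => [y z py Jz|y z Py Pz].
  by rewrite mulrA; apply: PM => //; apply: pow_prod.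
by rewrite mulrDr; apply: PD.
Qed.

Lemma pow_stable n : (forall x, pow n x -> pow n.+1 x) ->
  forall k x, pow n x -> pow (n + k) x.
Proof.
move=> stab; elim=> [|k IHk] x px; first by rewrite addn0.
move/stab: px; rewrite addnS; move: x; apply: powS_ind => [x y Jx py|].
  exact/pow_prod/IHk.
exact: powD.
Qed.

(** [J^i / J^(i+1)] has dimension at least [n] over the residue field. *)
Definition dim_ge (i n : nat) : Prop :=
  exists ts, [/\ size ts = n, {in ts, forall t, pow i t} &
                 independent (pow i.+1) ts].

Lemma dim_ge00 : dim_ge 0 1.
Proof.
by exists [:: 1]; split=> //; split=> // /pow1P; apply: (radical1 locJ).
Qed.

Lemma dim_ge2P i x y : pow i x -> pow i y -> ~ pow i.+1 x ->
  ~ adjoin (pow i.+1) x y -> dim_ge i 2.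
Proof.
move=> px py npx npy; exists [:: x; y]; split=> // t.
by rewrite !inE => /orP[]/eqP->.
Qed.

Lemma dim_ge3P i x y z : pow i x -> pow i y -> pow i z -> ~ pow i.+1 x ->
  ~ adjoin (pow i.+1) x y -> ~ adjoin (adjoin (pow i.+1) x) y z -> dim_ge i 3.
Proof.
move=> px py pz npx npy npz; exists [:: x; y; z]; split=> // t.
by rewrite !inE => /or3P[]/eqP->.
Qed.

(** With [ds = [:: d_i; d_(i+1); ...]] this is [#|J^i| >= q^(d_i + d_(i+1) + ...)],
    obtained by adjoining the independent families one layer after the other,
    the deepest layer first. *)
Lemma at_least_pow (T : seq R) ds i : unit_differences T ->
  (forall j, (j < size ds)%N -> dim_ge (i + j) (nth 0 ds j)) ->
  at_least (pow i) (size T ^ sumn ds).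
Proof.
move=> dT; elim: ds i => [|d ds IHds] i dims.
  by exists [:: 0]; split=> // x; rewrite inE => /eqP->; apply: pow_0.
have [|ts [szts pts ind]] := dims 0%N; first by [].
rewrite addn0 /= in szts pts ind *; rewrite expnD -szts.
apply: at_least_independent ind _ => //; try exact: left_ideal_pow.
- by move=> x; apply: pow_leq.
by apply: IHds => j jds; rewrite addSnnS; apply: dims.
Qed.

Section Nilpotent.
Hypothesis nilJ : exists n, forall x, pow n x -> x = 0.

(** Nakayama's lemma for a nilpotent radical. *)
Lemma pow_stable0 n : (forall x, pow n x -> pow n.+1 x) ->
  forall x, pow n x -> x = 0.
Proof.
move=> stab x px; have [m m0] := nilJ; apply: m0.
by apply: pow_leq (pow_stable stab m px); apply: leq_addl.
Qed.

Lemma dim_ge1P n : ~ dim_ge n 1 -> forall x, pow n x -> x = 0.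
Proof.
move=> nd; apply: pow_stable0 => x px; apply: NNPP => npx; apply: nd.
by exists [:: x]; split=> // t; rewrite inE => /eqP->.
Qed.

Lemma order_exists x : x <> 0 -> exists2 n, pow n x & ~ pow n.+1 x.
Proof.
move=> x0; apply: NNPP => H; have [n n0] := nilJ; apply: x0; apply: n0.
elim: n => // n IHn; apply: NNPP => npx; apply: H; by exists n.
Qed.

Lemma pow_unit_cancel n u x : ~ J u -> pow n (u * x) -> pow n x.
Proof.
move=> /(radicalC locJ)[v [vu _]] /(pow_mull v).
by rewrite mulrA vu mul1r.
Qed.

Lemma dim1_generator i x y : ~ dim_ge i 2 -> pow i x -> pow i y ->
  ~ pow i.+1 x -> adjoin (pow i.+1) x y.
Proof. by move=> nd px py npx; apply: NNPP => npy; apply/nd/(dim_ge2P px py). Qed.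

(** If [J = R x + J^2] then [J^i = R x^i + J^(i+1)] for all [i], so that
    nonzero elements are [a = u x^i] and [b = v x^j] up to higher order, with
    [u] and [v] invertible. Then [a * b = 0] forces [x^(i+j)] into
    [J^(i+j+1)], hence [J^(i+j) = 0], and [a * r * b] lies in it. *)
Lemma semicommutative_dim1 : ~ dim_ge 1 2 -> semicommutative_ring R.
Proof.
move=> nd a b ab0 r; apply: NNPP => arb0.
have [Ja _] := radical_zero_divisors ab0 arb0.
have nz0 : ~ (forall x, J x -> x = 0).
  by move=> J0; apply: arb0; rewrite (J0 a) // !mul0r.
have [x px npx] : exists2 x, pow 1 x & ~ pow 2 x.
  apply: NNPP => H; apply: nz0 => x /pow1P; apply: pow_stable0 x => x px.
  by apply: NNPP => npx; apply: H; exists x.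
have pX i : pow i (x ^+ i) by apply/pow_exp/pow1P.
have gen i y : pow i y -> adjoin (pow i.+1) (x ^+ i) y.
  elim: i y => [|i IHi] y; first by exists y; rewrite mulr1 subrr; apply: pow_0.
  move: y; apply: powS_ind => [y z Jy /IHi[s ps]|y z py pz]; last first.
    have lA := left_ideal_adjoin (x ^+ i.+1) (left_ideal_pow i.+2).
    by case: lA => _ AD _; apply: AD.
  have /(dim1_generator nd px)/(_ npx)[t pt] : pow 1 (y * s) by apply/pow1P/JMr.
  exists t; rewrite exprS.
  have -> : y * z - t * (x * x ^+ i)
     = y * (z - s * x ^+ i) + (y * s - t * x) * x ^+ i.
    by rewrite mulrBr mulrBl !mulrA addrA subrK.
  apply: powD; first exact: pow_prod.
  exact: (powM pt (pX i)).
have unitgen i y : pow i y -> ~ pow i.+1 y ->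
  exists2 u, ~ J u & pow i.+1 (y - u * x ^+ i).
  move=> py npy; have [u pu] := gen i y py; exists u => // Ju; apply: npy.
  by apply: pow_subr pu; apply: pow_prod.
have [i pa npa] : exists2 i, pow i a & ~ pow i.+1 a.
  by apply: order_exists => a0; apply: arb0; rewrite a0 !mul0r.
have [j pb npb] : exists2 j, pow j b & ~ pow j.+1 b.
  by apply: order_exists => b0; apply: arb0; rewrite b0 !mulr0.
have [u Ju pu] := unitgen _ _ pa npa.
have [v Jv pv] := unitgen _ _ pb npb.
have [v' [_ vv']] := radicalC locJ Jv.
have top0 : pow (i + j).+1 (x ^+ (i + j)) -> forall y, pow (i + j) y -> y = 0.
  by move=> pX1; apply: pow_stable0 => y /gen[s]; apply/pow_subr/pow_mull.
apply/arb0/top0; last by apply: powM pb; apply: pow_mulr.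
have [w pw] := gen i (x ^+ i * v) (pow_mulr v (pX i)).
have Jw : ~ J w \/ pow i.+1 (x ^+ i).
  case: (classic (J w)) => Jw; [right|by left].
  rewrite -[_ ^+ i]mulr1 -vv' mulrA; apply: pow_mulr.
  by apply: pow_subr pw; apply: pow_prod.
case: Jw => [Jw|pX1]; last first.
  by rewrite exprD -addSn; apply: powM.
apply: (pow_unit_cancel Jw); apply: (pow_unit_cancel Ju).
(* a, then b, then x ^+ i * v is replaced in a * b = 0 by its leading term;
   moving v across x ^+ i turns it into another unit w. *)
have p1 : pow (i + j).+1 (u * x ^+ i * b).
  have p0 : pow (i + j).+1 (a * b) by rewrite ab0; apply: pow_0.
  by apply: pow_subl p0 _; rewrite -mulrBl -addSn; apply: powM.
have p2 : pow (i + j).+1 (u * x ^+ i * (v * x ^+ j)).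
  apply: pow_subl p1 _; rewrite -mulrBr -addnS -mulrA.
  by apply: pow_mull; apply: powM.
rewrite exprD !mulrA in p2 *; apply: pow_subl p2 _.
rewrite -mulrBl -(mulrA u) -(mulrA u w) -mulrBr -mulrA -addSn.
by apply/pow_mull/powM.
Qed.

End Nilpotent.
End Powers.

(** * Reflexive local rings in which every element is central modulo the radical *)

Section CentralResidues.
Variables (R : nzRingType) (J : R -> Prop).
Hypothesis locJ : local_radical J.
Hypothesis reflR : reflexive_ring R.
Hypothesis centralJ : forall r, exists2 z, J (r - z) & forall x, z * x = x * z.
Notation pow := (pow J).
Notation dim_ge := (dim_ge J).

(** Only radical elements can violate semicommutativity: [a] and [b] are not
    invertible, and the central part of [r] contributes a multiple of
    [a * b]. *)
Lemma semicommutative_from_radical :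
  (forall a b r, J a -> J b -> J r -> a * b = 0 -> a * r * b = 0) ->
  semicommutative_ring R.
Proof.
move=> H a b ab0 r; apply: NNPP => arb0.
have [Ja Jb] := radical_zero_divisors locJ ab0 arb0.
have [z Jrz zC] := centralJ r; apply: arb0.
by rewrite -[r](subrK z) mulrDr mulrDl H // add0r -zC -mulrA ab0 mulr0.
Qed.

Lemma reflexive_from_radical x y : x * y = 0 ->
  (forall s, J s -> x * s * y = 0) -> forall s, y * s * x = 0.
Proof.
move=> xy0 xJy0; apply: reflR => s; have [z Jsz zC] := centralJ s.
by rewrite -[s](subrK z) mulrDr mulrDl xJy0 // add0r -zC -mulrA xy0 mulr0.
Qed.

(** Suppose [a * b = 0] and [a * r * b <> 0], with [J^4 = 0] and
    [J / J^2] of dimension at most 2. Were [a] and [b] independent modulo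
    [J^2], then [r] would be a combination of them and [a * r * b] would vanish;
    so [b] is a multiple of [a] modulo [J^2]. Then [a * a * r = 0], hence
    [a R (a * r) = 0], and reflexivity gives [a * r * a = 0]; but [a * r * b]
    is a multiple of it. *)
Lemma semicommutative_dim2 : (forall x, pow 4 x -> x = 0) -> ~ dim_ge 1 3 ->
  semicommutative_ring R.
Proof.
move=> p40 nd; apply: semicommutative_from_radical => a b r Ja Jb Jr ab0.
have p1J x : J x -> pow 1 x by move/(pow1P locJ).
apply: NNPP => arb0.
have npa : ~ pow 2 a.
  move=> pa; apply/arb0/p40; rewrite -mulrA.
  by apply: (powM locJ pa (powM locJ (p1J _ Jr) (p1J _ Jb))).
have npb : ~ pow 2 b.
  move=> pb; apply/arb0/p40.
  by apply: (powM locJ (powM locJ (p1J _ Ja) (p1J _ Jr)) pb).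
have aJ2b0 j : pow 2 j -> a * j * b = 0.
  move=> pj; apply: p40.
  by apply: (powM locJ (powM locJ (p1J _ Ja) pj) (p1J _ Jb)).
have aJJb0 s t : J s -> J t -> a * s * t * b = 0.
  move=> Js Jt; rewrite -(mulrA a); apply: aJ2b0.
  exact: (powM locJ (p1J _ Js) (p1J _ Jt)).
have aRab0 s : a * s * a * b = 0 by rewrite -mulrA ab0 mulr0.
(* If b were independent of a, then a, b, r would be independent. *)
have [m pm] : adjoin (pow 2) a b.
  apply: NNPP => npab; apply: nd.
  apply: (dim_ge3P (p1J _ Ja) (p1J _ Jb) (p1J _ Jr) npa npab).
  case=> t [s pst]; apply: arb0.
  have := aJ2b0 _ pst; rewrite !(mulrBr, mulrBl) !mulrA aRab0 subr0.
  have [z Jtz zC] := centralJ t; rewrite -[t](subrK z).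
  by rewrite mulrDr !mulrDl aJJb0 // add0r -zC -(mulrA z) ab0 mulr0 mul0r subr0.
have [z Jmz zC] := centralJ m.
have pz : pow 2 (b - z * a).
  have -> : b - z * a = (b - m * a) + (m - z) * a by rewrite mulrBl addrA subrK.
  by apply: (powD pm); apply: (powM locJ (p1J _ Jmz) (p1J _ Ja)).
have nJz : ~ J z.
  move=> Jz; apply/npb/(pow_subr _ pz).
  by apply: (powM locJ (p1J _ Jz) (p1J _ Ja)).
have [z' [z'z _]] := radicalC locJ nJz.
have aar0 : a * (a * r) = 0.
  have : a * (b - z * a) * r = 0.
    by apply: p40; apply: (powM locJ (powM locJ (p1J _ Ja) pz) (p1J _ Jr)).
  rewrite mulrBr mulrBl ab0 mul0r sub0r (mulrA a z) -zC -!mulrA => /eqP.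
  by rewrite oppr_eq0 => /eqP E; rewrite -[LHS]mul1r -z'z -mulrA E mulr0.
have ara0 : a * r * a = 0.
  rewrite -[a * r]mulr1; apply: reflexive_from_radical => // s Js; apply: p40.
  exact: (powM locJ (powM locJ (p1J _ Ja) (p1J _ Js)) (powM locJ (p1J _ Ja) (p1J _ Jr))).
apply: arb0; have : a * r * (b - z * a) = 0.
  by apply: p40; apply: (powM locJ (powM locJ (p1J _ Ja) (p1J _ Jr)) pz).
by rewrite mulrBr (mulrA _ z) -zC -mulrA ara0 mulr0 subr0.
Qed.
End CentralResidues.

(** * Reflexive local rings with residue field of order 2 *)

Section ResidueF2.
Variables (R : nzRingType) (J : R -> Prop).
Hypothesis locJ : local_radical J.
Let JMl := radicalMl locJ.
Let JMr := radicalMr locJ.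
Let JD := radicalD locJ.
Hypothesis nilJ : exists n, forall x, pow J n x -> x = 0.
Hypothesis reflR : reflexive_ring R.
Hypothesis resJ : forall r, J r \/ J (r - 1).
Notation pow := (pow J).
Notation dim_ge := (dim_ge J).
Let pow1 x : J x -> pow 1 x.
Proof. by move/(pow1P locJ). Qed.
Let pow_mulJ n x y : pow n x -> J y -> pow n.+1 (x * y).
Proof. by move=> px Jy; rewrite -addn1; apply: powM => //; apply: pow1. Qed.

Lemma central_residue r : exists2 z, J (r - z) & forall x, z * x = x * z.
Proof.
case: (resJ r) => Jr.
  by exists 0 => [|x]; rewrite ?subr0 // mulr0 mul0r.
by exists 1 => [//|x]; rewrite mulr1 mul1r.
Qed.

Lemma pow_double n x : pow n x -> pow n.+1 (x + x).
Proof.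
move=> px; rewrite -[x]mul1r -mulrDl; apply: pow_prod => //.
case: (resJ (- 1)) => [/(JMl (- 1))|/(JMl (- 1))].
  by rewrite mulrNN mulr1 => /(radical1 locJ).
by rewrite mulN1r opprB opprK.
Qed.

Lemma dim1_cases i x y : ~ dim_ge i 2 -> pow i x -> pow i y ->
  ~ pow i.+1 x -> pow i.+1 y \/ pow i.+1 (y - x).
Proof.
move=> nd px py npx; have [r pr] := dim1_generator nd px py npx.
case: (resJ r) => Jr; [left|right].
  by apply: pow_subr pr; apply: pow_prod.
have -> : y - x = (y - r * x) + (r - 1) * x by rewrite mulrBl mul1r addrA subrK.
exact: powD pr (pow_prod Jr px).
Qed.

(** A plane over the field of order 2 has the four elements 0, x, y, x + y. *)
Lemma dim2_cases i x y z : ~ dim_ge i 3 -> pow i x -> pow i y -> pow i z ->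
  ~ pow i.+1 x -> ~ pow i.+1 y -> ~ pow i.+1 (y - x) ->
  [\/ pow i.+1 z, pow i.+1 (z - x), pow i.+1 (z - y) | pow i.+1 (z - x - y)].
Proof.
move=> nd px py pz npx npy npyx.
have shift s t u : J (s - 1) -> pow i t -> pow i.+1 (u - s * t) ->
    pow i.+1 (u - t).
  move=> Js pt pu; rewrite (_ : u - t = u - s * t + (s - 1) * t).
    by apply: powD pu _; apply: pow_prod.
  by rewrite mulrBl mul1r addrA subrK.
have npa : ~ adjoin (pow i.+1) x y.
  case=> r; case: (resJ r) => Jr pr.
    by apply/npy/(pow_subr _ pr); apply: pow_prod.
  exact/npyx/(shift r).
have [s [r]] : adjoin (adjoin (pow i.+1) x) y z.
  by apply: NNPP => npz; apply/nd/(dim_ge3P px py pz).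
have kill t u v : J t -> pow i u -> pow i.+1 (v - t * u) -> pow i.+1 v.
  by move=> Jt pu; apply: pow_subr; apply: pow_prod.
case: (resJ r) => Jr; case: (resJ s) => Js.
- by move/(kill _ _ _ Jr px)/(kill _ _ _ Js py); constructor 1.
- by move/(kill _ _ _ Jr px)/(shift _ _ _ Js py); constructor 3.
- by move/(shift _ _ _ Jr px); rewrite addrAC => /(kill _ _ _ Js py); constructor 2.
by move/(shift _ _ _ Jr px); rewrite addrAC => /(shift _ _ _ Js py); constructor 4.
Qed.

Let reflJ := reflexive_from_radical reflR central_residue.

(** As [J^4 = 0] and [J^3] has at most one nonzero element, reflexivity makes
    [w * v = v * w] for [w] in [J^2] and [v] in [J]: products of three radical
    elements are invariant under cyclic rotation. If [a * b = 0] and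
    [a * r * b <> 0], then [b * a] and [a * r] form a basis of [J^2 / J^3].
    Expanding [r * b] in this basis gives [a * a * r <> 0], while expanding
    [r * a] gives [r * a * a = 0], against rotation. *)
Lemma semicommutative_cube_dim1 : (forall x, pow 4 x -> x = 0) ->
  ~ dim_ge 3 2 -> ~ dim_ge 2 3 -> semicommutative_ring R.
Proof.
move=> p40 d3 d2; apply: (semicommutative_from_radical locJ central_residue).
move=> a b r Ja Jb Jr ab0; apply: NNPP => arb0.
have eq3 x y : pow 3 x -> pow 3 y -> x <> 0 -> y <> 0 -> x = y.
  move=> px py x0 y0; have npx : ~ pow 4 x by move/p40.
  by case: (dim1_cases d3 px py npx) => /p40 // /subr0_eq.
have comm w v : pow 2 w -> J v -> w * v = v * w.
  move=> pw Jv.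
  have zl : w * v = 0 -> v * w = 0.
    move=> wv0; rewrite -[v]mulr1; apply: reflJ => // s Js; apply: p40.
    exact: pow_mulJ (pow_mulJ pw Js) Jv.
  have zr : v * w = 0 -> w * v = 0.
    move=> vw0; rewrite -[w]mulr1; apply: reflJ => // s Js; apply: p40.
    by rewrite -mulrA; apply: pow_prod Jv (pow_prod Js pw).
  case: (classic (w * v = 0)) => [wv0|wv0]; first by rewrite wv0 zl.
  case: (classic (v * w = 0)) => [vw0|vw0]; first by rewrite vw0 zr.
  by apply: eq3 => //; [apply: pow_mulJ|apply: pow_prod].
have p2 x y : J x -> J y -> pow 2 (x * y) by move=> Jx /pow1; apply: pow_prod.
have cyc x y z : J x -> J y -> J z -> x * y * z = z * x * y.
  by move=> Jx Jy Jz; rewrite -[RHS]mulrA; apply: comm Jz; apply: p2.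
have bab : b * a * b = 0 by rewrite cyc // cyc // ab0 mul0r.
have bar : b * a * r <> 0 by rewrite -cyc.
have npba : ~ pow 3 (b * a) by move=> p; apply: bar; apply: p40; apply: pow_mulJ.
have npar : ~ pow 3 (a * r) by move=> p; apply: arb0; apply: p40; apply: pow_mulJ.
have npd : ~ pow 3 (a * r - b * a).
  by move=> p; apply: arb0; have /p40 := pow_mulJ p Jb; rewrite mulrBl bab subr0.
have cases z (pz : pow 2 z) :=
  dim2_cases d2 (p2 _ _ Jb Ja) (p2 _ _ Ja Jr) pz npba npar npd.
have aar : a * a * r <> 0.
  move=> aar0; apply: arb0; have := cases (r * b) (p2 _ _ Jr Jb).
  have aba : a * (b * a) = 0 by rewrite mulrA ab0 mul0r.
  by case=> /(pow_prod Ja)/p40; rewrite ?mulrBr ?aba ?(mulrA a a) ?aar0 ?subr0 mulrA.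
apply: aar; rewrite cyc //.
have baa : b * a * a = 0 by rewrite -cyc // -mulrA ab0 mulr0.
have rab : r * a * b = 0 by rewrite -mulrA ab0 mulr0.
case: (cases (r * a) (p2 _ _ Jr Ja)) => p.
- exact: p40 (pow_mulJ p Ja).
- by have /p40 := pow_mulJ p Ja; rewrite mulrBl baa subr0.
- by have /p40/eqP := pow_mulJ p Jb; rewrite mulrBl rab sub0r oppr_eq0 => /eqP.
have /p40/eqP := pow_mulJ p Jb.
by rewrite !mulrBl rab bab subr0 sub0r oppr_eq0 => /eqP.
Qed.

(** A product of [i + 1] radical elements outside [J^(i+2)] can be turned into a
    power: if [u * w] is such a product and [u = y * v], then [u] and [v * w] are
    both nonzero in the line [J^i / J^(i+1)], so they agree there, and
    [v * w * w] is again outside [J^(i+2)]. Repeating this replaces every factor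
    by [w]. *)
Lemma power_top i : ~ dim_ge i 2 -> (exists2 y, pow i.+1 y & y <> 0) ->
  exists2 x, J x & ~ pow i.+1 (x ^+ i).
Proof.
move=> nd [y0 py0 ny0].
have [u pu [w Jw npuw]] :
    exists2 u, pow i u & exists2 w, J w & ~ pow i.+2 (u * w).
  apply: NNPP => H; apply: ny0; apply: pow_stable0 py0 => //.
  apply: powSr_ind => // [x y px Jy|]; last exact: powD.
  by apply: NNPP => npxy; apply: H; exists x => //; exists y.
exists w => //.
have shift k j v : (k + j)%N = i -> pow k v -> ~ pow i.+2 (v * w ^+ j.+1) ->
    ~ pow i.+1 (w ^+ i).
  elim: k j v => [|k IHk] j v kji pv npv.
    move=> pw; apply: npv; rewrite add0n in kji.
    by rewrite kji exprSr; apply/pow_mull/pow_mulJ.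
  have [y [v' [Jy pv' npyv']]] :
      exists y v', [/\ J y, pow k v' & ~ pow i.+2 (y * v' * w ^+ j.+1)].
    apply: NNPP => H; apply: npv; move: v pv; apply: powS_ind => [y v' Jy pv'|].
      by apply: NNPP => npyv; apply: H; exists y, v'.
    by move=> x y px py; rewrite mulrDl; apply: powD.
  have pwj m : pow m (w ^+ m) by apply: pow_exp.
  have pp : pow i (v' * w ^+ j.+1) by rewrite -kji addSnnS; apply: powM.
  have pq : pow i (y * v' * w ^+ j).
    by rewrite -kji; apply: powM => //; apply: pow_prod.
  have npp : ~ pow i.+1 (v' * w ^+ j.+1).
    by move=> p; apply: npyv'; rewrite -mulrA; apply: pow_prod.
  have npq : ~ pow i.+1 (y * v' * w ^+ j).
    by move=> p; apply: npyv'; rewrite exprSr mulrA; apply: pow_mulJ.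
  have [//|pd] := dim1_cases nd pp pq npp.
  apply: (IHk j.+1 v') => //; first by rewrite addnS -addSn.
  move=> p; apply: npyv'; apply: pow_subr p _.
  by rewrite exprSr mulrA (exprSr w j.+1) (mulrA v') -mulrBl; apply: pow_mulJ.
by apply: (shift i 0%N u) => //; rewrite ?addn0 ?expr1.
Qed.

(** Once [J^i = {0, x^i} + J^(i+1)], the same holds for every larger exponent. *)
Lemma power_generator i x : (0 < i)%N -> ~ dim_ge i 2 -> J x ->
  ~ pow i.+1 (x ^+ i) -> forall k y, (i <= k)%N -> pow k y ->
  pow k.+1 y \/ pow k.+1 (y - x ^+ k).
Proof.
move=> i0 nd Jx npx; elim=> [|k IHk] y; first by rewrite leqNgt i0.
rewrite leq_eqVlt => /orP[/eqP eik|]; last rewrite ltnS => ik.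
  by rewrite eik in npx nd *; move=> py; apply: dim1_cases => //; apply: pow_exp.
move: y; apply: powS_ind => [u v Ju pv|y z]; last first.
  case=> py [] pz; [left|right|right|left]; first exact: powD.
  - by rewrite -addrA; apply: powD.
  - by rewrite addrAC; apply: powD.
  have -> : y + z = y - x ^+ k.+1 + (z - x ^+ k.+1) + (x ^+ k.+1 + x ^+ k.+1).
    by rewrite [y - _ + _]addrACA -opprD subrK.
  by apply: powD; [apply: powD|apply: pow_double; apply: pow_exp].
have k0 : (0 < k)%N by apply: leq_trans ik.
have pux : pow k (u * x ^+ k.-1).
  by rewrite -[X in pow X](prednK k0); apply: pow_prod => //; apply: pow_exp.
have red : pow k.+2 (u * x ^+ k) \/ pow k.+2 (u * x ^+ k - x ^+ k.+1).
  rewrite -(prednK k0) exprSr mulrA prednK // (exprSr x k) -mulrBl.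
  by case: (IHk _ ik pux) => p; [left|right]; apply: pow_mulJ.
have [p|/(pow_prod Ju)] := IHk _ ik pv; first by left; apply: pow_prod.
rewrite mulrBr => p; case: red => pr; [left|right].
  exact: pow_subr pr p.
by rewrite -[_ * _](subrK (u * x ^+ k)) -addrA; apply: powD.
Qed.

(** Here [J^2] consists of multiples [x p] with [p] commuting with everything
    that commutes with [x], and every radical element is of the form [x g + k]
    where [g] is of the same kind and [k * x = 0]. For such [k] one finds
    [k R x = 0], so reflexivity gives [x R k = 0]. In a product of elements
    [x g + k] all mixed terms disappear, as do products of three factors [k];
    hence [a * r * b = x f (x g) (x h)] with [(x g) (x h) = - k * l], and
    [x f k = 0]. *)
Lemma semicommutative_square_dim1 : ~ dim_ge 2 2 -> semicommutative_ring R.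
Proof.
move=> nd; apply: (semicommutative_from_radical locJ central_residue).
move=> a b r Ja Jb Jr ab0.
have pow2 u v : J u -> J v -> pow 2 (u * v) by move=> Ju /pow1; apply: pow_prod.
case: (classic (exists2 y, pow 3 y & y <> 0)) => [ex|nex]; last first.
  apply: NNPP => arb0; apply: nex; exists (a * r * b) => //.
  by apply: pow_mulJ => //; apply: pow2.
have [x Jx npx] := power_top nd ex.
have gen := power_generator (isT : (0 < 2)%N) nd Jx npx.
(* C is the double commutant of x, a commutative subring. *)
pose C y := forall z, z * x = x * z -> z * y = y * z.
have CD y z : C y -> C z -> C (y + z).
  by move=> Cy Cz t tx; rewrite mulrDr mulrDl Cy // Cz.
have Cx y : C y -> x * y = y * x by move=> ->.
have CC y z : C y -> C z -> y * z = z * y by move=> /Cx Cy Cz; apply: Cz.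
have CxM y : C y -> C (x * y).
  by move=> Cy z zx; rewrite mulrA zx -mulrA Cy // mulrA.
have CX k : C (x ^+ k).
  by move=> z zx; apply: commrX; apply: zx.
(* Telescoping the expansions y = x^k + ... downwards from the top power. *)
have polyx k y : pow k.+2 y -> exists2 p, C p & pow k.+1 p /\ y = x * p.
  have [n n0] := nilJ.
  have [m] := ubnP (n - k); elim: m k y => // m IHm k y; rewrite ltnS => km py.
  case: (leqP n k.+2) => nk.
    exists 0; first by move=> z _; rewrite mulr0 mul0r.
    split; first exact: pow_0.
    by rewrite mulr0; apply: n0; apply: pow_leq py.
  have IH z : pow k.+3 z -> exists2 p, C p & pow k.+1 p /\ z = x * p.
    case/IHm => [|p Cp [pp ->]].
      by apply: leq_trans (ltn_sub2l _ (ltnSn k)) km; apply/ltnW/ltnW.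
    by exists p => //; split=> //; apply: pow_leq pp.
  have [/IH//|/IH[p Cp [pp]]] := gen k.+2 y isT py.
  move/(canRL (subrK _)) => ->; exists (p + x ^+ k.+1); first exact: CD.
  by rewrite mulrDr -exprS; split=> //; apply: powD => //; apply: pow_exp.
have split v : J v -> exists g k, [/\ C g, J k, k * x = 0 & v = x * g + k].
  move=> Jv.
  have [e Ce pe] : exists2 e, C e & pow 3 ((v - x * e) * x).
    have [p|p] := gen 2%N (v * x) isT (pow2 _ _ Jv Jx).
      by exists 0; [move=> z _; rewrite mulr0 mul0r|rewrite mulr0 subr0].
    by exists 1; [move=> z _; rewrite mulr1 mul1r|rewrite mulr1 mulrBl -expr2].
  have [p Cp [/(polyx 0%N)[q Cq [_ epq]] ep]] := polyx 1%N _ pe.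
  exists (e + q), (v - x * e - p); split; first exact: CD.
  - rewrite epq; apply: JD; last by rewrite -mulrN; apply: JMr.
    by apply: JD => //; rewrite -mulrN; apply: JMr.
  - by rewrite mulrBl ep Cx // subrr.
  by rewrite epq mulrDr -[v - _ - _]addrA -opprD [RHS]addrC subrK.
have xRk k : J k -> k * x = 0 -> forall s, x * s * k = 0.
  move=> Jk kx0; apply: (reflJ kx0) => s /split[g [k' [_ _ k'x0 ->]]].
  by rewrite mulrDr mulrDl !mulrA kx0 !mul0r -mulrA k'x0 mulr0 addr0.
have [g [k [Cg Jk kx0 ea]]] := split a Ja.
have [h [l [Ch Jl lx0 eb]]] := split b Jb.
have [f [m [Cf Jm mx0 er]]] := split r Jr.
have xk u v : J u -> u * x = 0 -> x * v * u = 0 by move=> Ju ux0; apply: xRk.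
have eab : x * g * (x * h) = - (k * l).
  apply/eqP; rewrite -addr_eq0 -ab0 ea eb mulrDr !mulrDl (xk l) //.
  by rewrite add0r (mulrA k) kx0 mul0r addr0.
have ear : a * r = x * f * (x * g) + k * m.
  rewrite ea er mulrDr !mulrDl (xk m) // add0r (mulrA k) kx0 mul0r addr0.
  by rewrite (CC (x * g)) //; apply: CxM.
have [p Cp [_ ekm]] := polyx 0%N _ (pow2 _ _ Jk Jm).
have kml : k * m * l = 0 by rewrite ekm xRk.
have kmx : k * m * (x * h) = 0 by rewrite mulrA -(mulrA k) mx0 mulr0 mul0r.
have fgl : x * f * (x * g) * l = 0 by rewrite -(mulrA (x * f)) (xRk l) ?mulr0.
rewrite ear eb mulrDr !mulrDl kmx kml fgl !addr0 -mulrA eab mulrN mulrA.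
by rewrite (xRk k) // mul0r oppr0.
Qed.

Lemma commutator_additive n v u1 u2 : pow n (u1 * v - v * u1) ->
  pow n (u2 * v - v * u2) -> pow n ((u1 + u2) * v - v * (u1 + u2)).
Proof. by move=> p1 p2; rewrite mulrDl mulrDr opprD addrACA; apply: powD. Qed.

(** The layers [J^i / J^(i+1)] have dimensions at most 2, 2, 1, 1, and only the
    case where [J^4] is not 0 and [J] is not principal is new. Choose [x] with
    [x^3] outside [J^4] and then [k] independent of [x] with [k * x^2 = 0]. Since [x^4 <> 0] spans [J^4], every product of four radical
    elements that involves [k] vanishes, and reflexivity yields
    [x^2 * k = x * k * x = 0]. These relations and the bound on [J^2 / J^3]
    place [x * k - k * x] in [J^4]. As [x] and [k] generate [J] modulo [J^2], all
    commutators of radical elements are then in [J^4], so that [a * r * b] and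
    [r * a * b] coincide. *)
Lemma semicommutative_dims_2211 : (forall x, pow 5 x -> x = 0) ->
  ~ dim_ge 1 3 -> ~ dim_ge 2 3 -> ~ dim_ge 3 2 -> ~ dim_ge 4 2 ->
  semicommutative_ring R.
Proof.
move=> p50 d1 d2 d3 d4.
case: (classic (exists2 y, pow 4 y & y <> 0)) => [ex|nex]; last first.
  apply: (semicommutative_dim2 locJ reflR central_residue) d1 => y py.
  by apply: NNPP => y0; apply: nex; exists y.
case: (classic (dim_ge 1 2)) => [d1ge|]; last exact: semicommutative_dim1.
have [x Jx npx] := power_top d3 ex.
have gen3 y : pow 3 y -> pow 4 y \/ pow 4 (y - x ^+ 3).
  by apply: (power_generator _ d3 Jx npx).
have gen4 y : pow 4 y -> y = 0 \/ y = x ^+ 4.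
  move=> py; have [//||/p50|/p50/subr0_eq] := power_generator _ d3 Jx npx (k := 4) _ py => //.
    by left.
  by right.
have x40 : x ^+ 4 <> 0.
  by case: ex => y /gen4[->|->].
have pX n : pow n (x ^+ n) by apply: pow_exp.
have x4N y : pow 5 (y - x ^+ 4) -> y <> 0.
  by move=> /p50/subr0_eq->.
have [k0 Jk0 [npk0 npk0x]] : exists2 v, J v & ~ pow 2 v /\ ~ pow 2 (v - x).
  apply: NNPP => H; have {}H v : pow 1 v -> pow 2 v \/ pow 2 (v - x).
    move/(pow1P locJ) => Jv; apply: NNPP => nor; apply: H; exists v => //.
    by split=> p; apply: nor; [left|right].
  case: d1ge => ts [szts p1ts]; case: ts szts p1ts => [|s [|t [|]]] // _ p1ts.
  case=> nps [npt _]; have [//|ps] := H s (p1ts _ (mem_head _ _)).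
  have [||pt] := H t; first by apply: p1ts; rewrite !inE eqxx orbT.
    by move=> pt; apply/npt/sub_adjoin.
  apply: npt; exists 1; rewrite mul1r -[t](subrK x) -addrA.
  by apply: powD => //; apply: pow_subC.
(* Where necessary, k0 is corrected by x to bring k0 x^2 into J^4, and then by
   x^2 to make it vanish. *)
have [k Jk [kxx npk]] : exists2 k, J k & k * x ^+ 2 = 0 /\ ~ pow 2 k.
  have [k1 Jk1 [pk1 npk1]] :
      exists2 v, J v & pow 4 (v * x ^+ 2) /\ ~ pow 2 v.
    have [p|p] := gen3 _ (pow_prod Jk0 (pX 2%N)); first by exists k0.
    exists (k0 - x); first by apply: JD => //; rewrite -mulN1r; apply: JMl.
    by split=> //; rewrite mulrBl -exprS.
  case: (gen4 _ pk1) => [e|e]; first by exists k1.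
  exists (k1 - x ^+ 2).
    by apply: JD => //; rewrite expr2 -mulrN; apply: JMr.
  split; first by rewrite mulrBl e -exprD subrr.
  by move=> p; apply: npk1; apply: pow_subr (pX 2%N) p.
have npxk : ~ pow 2 (k - x).
  move=> p; apply: npx; have /(powN locJ) := powM locJ p (pX 2%N).
  by rewrite mulrBl kxx sub0r opprK -exprS.
have npx1 : ~ pow 2 x.
  move=> p; apply: npx; rewrite exprS.
  by apply: (powM locJ p (pX 2%N)).
have Jind (Q : R -> Prop) : (forall u v, Q u -> Q v -> Q (u + v)) ->
    Q x -> Q k -> (forall w, pow 2 w -> Q w) -> forall v, J v -> Q v.
  move=> QD Qx Qk Qp v Jv; have pq u w : Q u -> pow 2 (w - u) -> Q w.
    by move=> Qu /Qp Qw; rewrite -[w](subrK u); apply: QD.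
  have := dim2_cases d1 (pow1 Jx) (pow1 Jk) (pow1 Jv) npx1 npk npxk.
  case=> [/Qp|/pq|/pq|] //; first by auto.
    by auto.
  by rewrite -addrA -opprD => /pq; apply; apply: QD.
have kJ3 w : pow 3 w -> k * w = 0.
  move=> /gen3[p|/(pow_prod Jk)/p50]; first by apply/p50/pow_prod.
  by rewrite mulrBr (exprSr x 2) (mulrA k) kxx mul0r subr0.
have xxRk s : x ^+ 2 * s * k = 0.
  move: s; apply: reflJ => // s Js; rewrite -mulrA.
  by apply/kJ3/(pow_prod Js).
have J3k w : pow 3 w -> w * k = 0.
  move=> /gen3[p|p]; first by apply/p50/pow_mulJ.
  have /p50 := pow_mulJ p Jk.
  by rewrite mulrBl exprSr xxRk subr0.
have kJJ w : pow 2 w -> pow 4 (k * w).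
  move=> pw; have [//|p] := gen3 _ (pow_prod Jk pw).
  have := pow_mulJ p Jx; rewrite mulrBl -exprSr => /x4N[].
  by rewrite -mulrA kJ3 //; apply: pow_mulJ.
have JJk w : pow 2 w -> pow 4 (w * k).
  move=> pw; have [//|p] := gen3 _ (pow_mulJ pw Jk).
  have := pow_prod Jx p; rewrite mulrBr -exprS => /x4N[].
  by rewrite mulrA J3k //; apply: pow_prod.
have kxRx s : x * s * (k * x) = 0.
  move: s; apply: reflJ => [|s Js]; first by rewrite -mulrA -expr2.
  by rewrite -!mulrA kJ3 //; apply: pow_prod => //; apply: pow_prod (pow1 Jx).
have kxx' : k * x * x = 0 by rewrite -mulrA -expr2.
have xkx : x * k * x = 0 by rewrite -mulrA -[X in X * _]mulr1 kxRx.
have xxk : x * (x * k) = 0 by rewrite mulrA -expr2 -[_ ^+ 2]mulr1 xxRk.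
have x3C w : w = 0 \/ w = x ^+ 4 -> exists2 u, pow 3 u & u * x = w /\ x * u = w.
  case=> ->; [exists 0|exists (x ^+ 3)]; rewrite ?mulr0 ?mul0r -?exprSr -?exprS //.
  exact: pow_0.
(* If k * x or x * k is in J^3, then it vanishes after a multiple of x^3 is
   subtracted from k, and by reflexivity so does the product in the other order.
   Otherwise x^2 and k * x form a basis of J^2 / J^3 in which x * k is
   expanded. *)
have comm : pow 4 (x * k - k * x).
  case: (classic (pow 3 (k * x))) => [pkx|npkx].
    have {pkx} : pow 4 (k * x).
      have [//|p] := gen3 _ pkx.
      have := pow_mulJ p Jx; rewrite mulrBl -exprSr => /x4N[].
      by rewrite kxx'.
    move=> pkx; have [u pu [ux xu]] := x3C _ (gen4 _ pkx).
    have kux : (k - u) * x = 0 by rewrite mulrBl ux subrr.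
    suff /(_ 1) : forall s, x * s * (k - u) = 0.
      by rewrite mulr1 mulrBr xu => ->; apply: pow_0.
    apply: reflJ => //.
    apply: Jind => [s t es et|||w pw].
    - by rewrite mulrDr mulrDl es et addr0.
    - by rewrite kux mul0r.
    - rewrite !mulrBl -!mulrA; apply: p50; apply: (powB locJ); first exact: pow_prod.
      by apply: (powM locJ pu); apply: pow_prod => //; apply: pow1.
    rewrite !mulrBl -!mulrA kJ3 ?sub0r; last exact: pow_mulJ.
    apply: p50; apply: (powN locJ); apply: (@pow_leq _ _ locJ _ 6) => //.
    exact: (powM locJ pu (pow_mulJ pw Jx)).
  case: (classic (pow 3 (x * k))) => [pxk|npxk3].
    have {pxk} : pow 4 (x * k).
      have [//|p] := gen3 _ pxk.
      have := pow_prod Jx p; rewrite mulrBr -exprS => /x4N[].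
      by rewrite xxk.
    move=> pxk; have [u pu [ux xu]] := x3C _ (gen4 _ pxk).
    have xku : x * (k - u) = 0 by rewrite mulrBr xu subrr.
    suff /(_ 1) : forall s, (k - u) * s * x = 0.
      by rewrite mulr1 mulrBl ux => /eqP; rewrite subr_eq0 => /eqP->; rewrite subrr; apply: pow_0.
    apply: reflJ => //; apply: Jind => [s t es et|||w pw].
    - by rewrite (mulrDr x) mulrDl es et addr0.
    - rewrite mulrBr -(mulrA x x k) xxk sub0r; apply: p50.
      by apply: (powN locJ); apply: (powM locJ (pow_prod Jx (pow1 Jx)) pu).
    - rewrite mulrBr; apply: p50; apply: (powB locJ); first exact: pow_mulJ.
      by apply: (powM locJ (pow_prod Jx (pow1 Jk)) pu).
    rewrite mulrBr J3k ?sub0r; last exact: pow_prod.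
    apply: p50; apply: (powN locJ).
    apply: (@pow_leq _ _ locJ _ 6) => //.
    exact: (powM locJ (pow_prod Jx pw) pu).
  have npx2 : ~ pow 3 (x ^+ 2).
    by move=> p; apply: npx; rewrite exprS; apply: pow_prod.
  have npx3 y : y * x = 0 -> ~ pow 3 (y - x ^+ 2).
    move=> yx /pow_mulJ/(_ Jx); rewrite mulrBl yx sub0r -exprSr.
    by move/(powN locJ); rewrite opprK.
  have [] // := dim2_cases d2 (pX 2%N) (pow_prod Jk (pow1 Jx))
    (pow_prod Jx (pow1 Jk)) npx2 npkx (npx3 _ kxx').
  - by move/(npx3 _ xkx).
  - move=> p; have [//|q] := gen3 _ p.
    have := pow_mulJ q Jx; rewrite !mulrBl xkx kxx' subrr -exprSr.
    by move/x4N.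
  by rewrite addrAC => /npx3[]; rewrite mulrBl xkx kxx' subrr.
(* Used for n = 3 first, then for n = 4 with the hypothesis derived from n = 3. *)
have comJ n : pow n (x * k - k * x) ->
    (forall u w, J u -> pow 2 w -> pow n (u * w - w * u)) ->
    forall u v, J u -> J v -> pow n (u * v - v * u).
  move=> pxk pJ2.
  have C0 u : pow n (u * u - u * u) by rewrite subrr; apply: pow_0.
  have pkx : pow n (k * x - x * k) by apply: pow_subC.
  have pJ2' u w : J u -> pow 2 w -> pow n (w * u - u * w).
    by move=> Ju pw; apply: pow_subC => //; apply: pJ2.
  have H g : J g -> pow n (x * g - g * x) -> pow n (k * g - g * k) ->
      forall u, J u -> pow n (u * g - g * u).
    move=> Jg px pk; apply: Jind => // [u1 u2|w pw]; last exact: pJ2'.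
    exact: commutator_additive.
  move=> u v Ju Jv; apply: pow_subC => //; move: v Jv; apply: Jind => [v1 v2|||w pw].
  - exact: commutator_additive.
  - by apply: pow_subC => //; apply: H.
  - by apply: pow_subC => //; apply: H.
  exact: pJ2'.
have comJ3 : forall u v, J u -> J v -> pow 3 (u * v - v * u).
  apply: comJ => [|u w Ju pw]; first exact: (@pow_leq _ _ locJ _ 4).
  by apply: (powB locJ); [apply: pow_prod|apply: pow_mulJ].
have comJ2 u w : J u -> pow 2 w -> pow 4 (u * w - w * u).
  move=> Ju; move: w; apply: powS_ind => [y z Jy /(pow1P locJ) Jz|w1 w2 p1 p2].
    have -> : u * (y * z) - y * z * u
        = (u * y - y * u) * z + y * (u * z - z * u).
      by rewrite mulrBl mulrBr !mulrA addrA subrK.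
    by apply: powD; [apply/pow_mulJ/Jz/comJ3|apply/pow_prod/comJ3].
  by rewrite mulrDl mulrDr opprD addrACA; apply: powD.
apply: (semicommutative_from_radical locJ central_residue) => a b r Ja Jb Jr ab0.
have /p50 : pow 5 ((a * r - r * a) * b) by apply: pow_mulJ => //; apply: comJ.
by rewrite mulrBl -(mulrA r) ab0 mulr0 subr0.
Qed.
End ResidueF2.

(** * Reflexive local rings with fewer than 256 elements *)

Section SmallLocal.
Variables (R : nzRingType) (J : R -> Prop).
Hypothesis locJ : local_radical J.
Hypothesis nilJ : exists n, forall x, pow J n x -> x = 0.
Hypothesis reflR : reflexive_ring R.
Hypothesis small : ~ at_least (fun _ : R => True) 256.

Lemma unit_differences_cons u T : unit_differences T ->
  {in T, forall v, ~ J (u - v)} -> unit_differences (u :: T).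
Proof.
move=> [uT dT] uJ; split=> [|v w].
  rewrite /= uT andbT; apply/negP => /uJ[].
  by rewrite subrr; apply: radical0.
have left_inv x : ~ J x -> exists y, y * x = 1.
  by move=> /(radicalC locJ)[y [yx _]]; exists y.
rewrite !inE => /predU1P[->|vT] /predU1P[->|wT]; rewrite ?eqxx // => nvw.
- exact/left_inv/uJ.
- apply: left_inv => /(radicalMl locJ (- 1)).
  by rewrite mulN1r opprB; apply: uJ.
exact: dT.
Qed.

Lemma dims_small (T : seq R) ds : unit_differences T ->
  (forall j, (j < size ds)%N -> dim_ge J j (nth 0 ds j)) ->
  (size T ^ sumn ds < 256)%N.
Proof.
move=> dT dims; rewrite ltnNge; apply/negP => big; apply: small.
exact: leq_at_least big (at_least_pow locJ (i := 0) dT dims).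
Qed.

(** The possible values of [q] and of the dimensions [d_i] of [J^i / J^(i+1)]
    are those with [q^(1 + d_1 + d_2 + ...) < 256]. With [d_1 >= 2] and
    [d_2 >= 1] this leaves [q <= 3], and then residues are central, so that
    [J^3 = 0] would already give semicommutativity. For [q = 3] there remains
    [(d_i) = (2, 1, 1)]; for [q = 2], where the [d_i] add up to at most 6, either
    [d_2 = 1], or [(d_i)] is one of (3, 2, 1) and (2, 2, 1, 1), or
    [d_1 = 2] and [J^4 = 0]. *)
Lemma semicommutative_small_local : semicommutative_ring R.
Proof.
case: (classic (dim_ge J 1 2)) => [d12|]; last exact: semicommutative_dim1.
have pow1 x : J x -> pow J 1 x by move/(pow1P locJ).
have pow3 x y z : J x -> J y -> J z -> pow J 3 (x * y * z).
  move=> Jx Jy Jz; rewrite -mulrA.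
  by apply: (pow_prod Jx (pow_prod Jy (pow1 _ Jz))).
have d01 := dim_ge00 locJ.
case: (classic (dim_ge J 2 1)) => [d21|nd]; last first.
  have J20 := dim_ge1P locJ nilJ nd.
  move=> a b ab0 r; apply: NNPP => arb0.
  have [Ja Jb] := radical_zero_divisors locJ ab0 arb0.
  by apply/arb0/J20/(pow_prod _ (pow1 _ Jb))/(radicalMr locJ).
have J0 := radical0 locJ.
have nJ1 := radical1 locJ.
have JN x : J (- x) -> J x.
  by move/(radicalMl locJ (- 1)); rewrite mulN1r opprK.
have T2 : unit_differences [:: 1; 0 : R].
  apply: unit_differences_cons => [|v]; last first.
    by rewrite inE => /eqP->; rewrite subr0.
  by apply: (@unit_differences_cons 0 [::]) => //; split=> [|v w]; rewrite ?in_nil.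
have nT4 (T : seq R) : unit_differences T -> size T <> 4%N.
  move=> dT szT; suff : (size T ^ sumn [:: 1; 2; 1] < 256)%N by rewrite szT.
  by apply: dims_small => // -[|[|[|]]].
case: (classic (forall r, J r \/ J (r - 1))) => [resJ|nres].
  have dims ds : (forall j, (j < size ds)%N -> dim_ge J j (nth 0 ds j)) ->
      (sumn ds < 8)%N.
    move/(dims_small T2) => H; rewrite -(ltn_exp2l _ 8 (isT : (1 < 2)%N)).
    exact: H.
  case: (classic (dim_ge J 2 2)) => [d22|]; last exact: (semicommutative_square_dim1 locJ).
  have centralJ := central_residue resJ.
  case: (classic (dim_ge J 3 1)) => [d31|nd31]; last first.
    apply: (semicommutative_from_radical locJ) => // a b r Ja Jb Jr ab0.
    by apply: (dim_ge1P locJ nilJ nd31); apply: pow3.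
  case: (classic (dim_ge J 1 3)) => [d13|nd13].
    apply: (semicommutative_cube_dim1 locJ) => //.
    - apply: (dim_ge1P locJ nilJ) => d41.
      suff : (sumn [:: 1; 3; 2; 1; 1] < 8)%N by [].
      by apply: dims => -[|[|[|[|[|]]]]].
    - move=> d32; suff : (sumn [:: 1; 3; 2; 2] < 8)%N by [].
      by apply: dims => -[|[|[|[|]]]].
    move=> d23; suff : (sumn [:: 1; 3; 3; 1] < 8)%N by [].
    by apply: dims => -[|[|[|[|]]]].
  case: (classic (dim_ge J 4 1)) => [d41|nd41]; last first.
    apply: (semicommutative_dim2 locJ) => //.
    exact: (dim_ge1P locJ nilJ nd41).
  apply: (semicommutative_dims_2211 locJ) => //.
  - apply: (dim_ge1P locJ nilJ) => d51.
    suff : (sumn [:: 1; 2; 2; 1; 1; 1] < 8)%N by [].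
    by apply: dims => -[|[|[|[|[|[|]]]]]].
  - move=> d23; suff : (sumn [:: 1; 2; 3; 1; 1] < 8)%N by [].
    by apply: dims => -[|[|[|[|[|]]]]].
  - move=> d32; suff : (sumn [:: 1; 2; 2; 2; 1] < 8)%N by [].
    by apply: dims => -[|[|[|[|[|]]]]].
  move=> d42; suff : (sumn [:: 1; 2; 2; 1; 2] < 8)%N by [].
  by apply: dims => -[|[|[|[|[|]]]]].
have [u [Ju Ju1]] : exists u, ~ J u /\ ~ J (u - 1).
  apply: NNPP => H; apply: nres => r; apply: NNPP => nJr; apply: H.
  by exists r; split=> Jr; apply: nJr; [left|right].
have T3 : unit_differences [:: u; 1; 0].
  apply: unit_differences_cons => // v; rewrite !inE => /orP[]/eqP->//.
  by rewrite subr0.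
have res3 r : [\/ J (r - u), J (r - 1) | J r].
  apply: NNPP => nJr; apply: (nT4 [:: r; u; 1; 0]) => //.
  apply: unit_differences_cons => // v; rewrite !inE => /or3P[]/eqP->.
  - by move=> Jr; apply: nJr; constructor 1.
  - by move=> Jr; apply: nJr; constructor 2.
  by rewrite subr0 => Jr; apply: nJr; constructor 3.
(* Otherwise u + 1 would be a fourth residue. *)
have J2 : ~ J (1 + 1).
  move=> J2; case: (res3 (u + 1)) => [|| Ju2].
  - by rewrite addrAC subrr add0r.
  - by rewrite addrK.
  apply: Ju1; rewrite -(addrK 1 u) -addrA -opprD.
  by apply: (radicalD locJ) => //; apply: JN; rewrite opprK.
have Jm1u : J (- 1 - u).
  case: (res3 (- 1)) => // [|/JN//]; rewrite -opprD => /JN //.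
have centralJ r : exists2 z, J (r - z) & forall x, z * x = x * z.
  case: (res3 r) => Jr.
  - exists (- 1); last by move=> x; rewrite mulN1r mulrN1.
    have -> : r - - 1 = (r - u) - (- 1 - u).
      by rewrite opprB [RHS]addrA subrK.
    by apply: (radicalD locJ) => //; apply: JN; rewrite opprK.
  - by exists 1 => // x; rewrite mul1r mulr1.
  by exists 0 => [|x]; rewrite ?subr0 // mul0r mulr0.
case: (classic (dim_ge J 3 1)) => [d31|nd31]; last first.
  apply: (semicommutative_from_radical locJ) => // a b r Ja Jb Jr ab0.
  by apply: (dim_ge1P locJ nilJ nd31); apply: pow3.
have dims ds : (forall j, (j < size ds)%N -> dim_ge J j (nth 0 ds j)) ->
    (sumn ds < 6)%N.
  move/(dims_small T3) => H; rewrite -(ltn_exp2l _ 6 (isT : (1 < 3)%N)).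
  exact: ltn_trans H _.
apply: (semicommutative_dim2 locJ) => //.
  apply: (dim_ge1P locJ nilJ) => d41.
  suff : (sumn [:: 1; 2; 1; 1; 1] < 6)%N by [].
  by apply: dims => -[|[|[|[|[|]]]]].
move=> d13; suff : (sumn [:: 1; 3; 1; 1] < 6)%N by [].
by apply: dims => -[|[|[|[|]]]].
Qed.

End SmallLocal.

(** * Rings with few elements and trivial idempotents are local *)

Definition nilpotent_element (R : nzRingType) (x : R) : Prop :=
  exists n, x ^+ n = 0.

Lemma pigeonhole (R : nzRingType) N (f : nat -> R) :
  ~ (exists g : 'I_N -> R, injective g) ->
  exists i j, [/\ (i < j)%N, (j < N)%N & f i = f j].
Proof.
move=> small; apply: NNPP => H; apply: small; exists (fun i : 'I_N => f i).
move=> i j fij; apply/val_inj/eqP; rewrite eqn_leq.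
apply/andP; split; rewrite leqNgt; apply/negP => ij; apply: H.
  by exists (val j), (val i); split=> //; apply: ltn_ord.
by exists (val i), (val j); split=> //; apply: ltn_ord.
Qed.

Section TrivialIdempotents.
Variable (R : nzRingType) (N : nat).
Hypothesis small : ~ exists f : 'I_N -> R, injective f.
Hypothesis idem01 : forall e : R, e * e = e -> e = 0 \/ e = 1.
Local Notation nil := (@nilpotent_element R).

Lemma mul_nilpotent_fixed (p w : R) : nil w -> p * w = p -> p = 0.
Proof.
case=> n wn0 pw; rewrite -[p]mulr1 -[RHS](mulr0 p) -wn0.
elim: n {wn0} => [|n IHn]; first by rewrite mulr1.
by rewrite exprS mulrA pw.
Qed.

Lemma nilpotent_left_inverse (x y : R) : nil x -> y * x <> 1.
Proof.
case=> n xn0 yx; have : y ^+ n * x ^+ n = 1.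
  elim: n {xn0} => [|n IHn]; first by rewrite mulr1.
  by rewrite exprSr exprS mulrA -(mulrA _ y) yx mulr1.
by rewrite xn0 mulr0 => /eqP; rewrite eq_sym oner_eq0.
Qed.

(** The powers of [x] are eventually periodic, so one of them is idempotent. *)
Lemma nilpotent_or_unit (x : R) : ~ nil x -> exists y, y * x = 1 /\ x * y = 1.
Proof.
move=> nx; have [i [j [ij _ xij]]] := pigeonhole (fun k => x ^+ k) small.
have d0 : (0 < j - i)%N by rewrite subn_gt0.
have period k : (i <= k)%N -> x ^+ (k + (j - i)) = x ^+ k.
  move=> ik; rewrite -(subnK ik) -addnA subnKC; last exact: ltnW.
  by rewrite !exprD -xij.
have periods m k : (i <= k)%N -> x ^+ (k + m * (j - i)) = x ^+ k.
  move=> ik; elim: m => [|m IHm]; first by rewrite addn0.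
  by rewrite mulSn addnCA addnC period // (leq_trans ik) // leq_addr.
have [n en] : exists n, (i.+1 * (j - i) = n.+1)%N.
  by exists (i.+1 * (j - i)).-1; rewrite prednK // muln_gt0.
have idem : x ^+ n.+1 * x ^+ n.+1 = x ^+ n.+1.
  rewrite -exprD -[in X in (_ + X)%N]en periods // -en.
  by apply: leq_trans (leqnSn i) _; rewrite leq_pmulr.
have [x0|x1] := idem01 idem; first by case: nx; exists n.+1.
by exists (x ^+ n); rewrite -exprSr -exprS.
Qed.

Lemma nilpotentMl (r x : R) : nil x -> nil (r * x).
Proof.
move=> nx; apply: NNPP => /nilpotent_or_unit[y []]; rewrite mulrA => yrx _.
exact: nilpotent_left_inverse nx yrx.
Qed.

Lemma nilpotentMr (r x : R) : nil x -> nil (x * r).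
Proof.
case=> n xn0; have [m] := nilpotentMl r (ex_intro _ n xn0).
move=> rxm; exists m.+1; rewrite exprSr.
suff -> : (x * r) ^+ m * (x * r) = x * (r * x) ^+ m * r.
  by rewrite rxm mulr0 mul0r.
elim: m {rxm} => [|m IHm]; first by rewrite mul1r mulr1.
by rewrite exprS -(mulrA (x * r)) IHm exprS !mulrA.
Qed.

(** If [u * (x + y) = 1], then [1 - u * x = u * y] is nilpotent, yet right
    multiplication by [1 - w] is injective for nilpotent [w]. *)
Lemma nilpotentD (x y : R) : nil x -> nil y -> nil (x + y).
Proof.
move=> nx ny; apply: NNPP => /nilpotent_or_unit[u [uxy _]].
have [k vk0] := nilpotentMl u ny; have nw := nilpotentMl u nx.
suff : (u * y) ^+ 0 = 0 by move/eqP; rewrite oner_eq0.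
elim: k vk0 => // k IHk; rewrite exprSr => vk0; apply: IHk.
apply: mul_nilpotent_fixed nw _; rewrite -[LHS]addr0 -vk0 -mulrDr -mulrDr.
by rewrite uxy mulr1.
Qed.

Lemma nilpotent_local_radical : local_radical nil.
Proof.
split.
- exact: nilpotentD.
- exact: nilpotentMl.
- exact: nilpotentMr.
- by case=> n; rewrite expr1n => /eqP; rewrite oner_eq0.
exact: nilpotent_or_unit.
Qed.

(** Two of the initial partial products coincide: [P = P * m] with [m] nilpotent,
    so that [P = 0]. *)
Lemma prod_nilpotent (s : seq R) : size s = N -> {in s, forall x, nil x} ->
  \prod_(x <- s) x = 0.
Proof.
move=> szs nils.
have [i [j [ij jN]]] := pigeonhole (fun i => \prod_(x <- take i s) x) small.
have -> : take j s = take i s ++ drop i (take j s).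
  by rewrite -{1}(cat_take_drop i (take j s)) take_takel // ltnW.
rewrite big_cat /= => /esym/mul_nilpotent_fixed Pi0.
rewrite -(cat_take_drop i s) big_cat /= Pi0 ?mul0r //.
have : size (drop i (take j s)) = (j - i)%N.
  by rewrite size_drop size_takel // szs ltnW.
have : {in drop i (take j s), forall x, nil x}.
  by move=> x /mem_drop/mem_take; apply: nils.
case: (drop _ _) => [_|x t nilt _]; first by move/esym/eqP; rewrite subn_eq0 leqNgt ij.
by rewrite big_cons; apply/nilpotentMr/nilt; rewrite inE eqxx.
Qed.

Lemma nilpotent_radical_pow x : pow nil N x -> x = 0.
Proof.
have gen n z : (forall s : seq R, size s = n -> {in s, forall t, nil t} ->
    z * \prod_(t <- s) t = 0) -> forall y, pow nil n y -> z * y = 0.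
  elim: n z => [|n IHn] z prod0 y.
    by have := prod0 [::] erefl; rewrite big_nil mulr1 => -> //; rewrite mul0r.
  move: y; apply: powS_ind => [y w ny pw|y w zy zw]; last first.
    by rewrite mulrDr zy zw addr0.
  rewrite mulrA; apply: IHn pw => s szs nils.
  rewrite -mulrA; have := prod0 (y :: s); rewrite big_cons /= szs; apply=> // t.
  by rewrite inE => /predU1P[->|/nils].
move=> px; rewrite -[x]mul1r; apply: gen px => s szs nils.
by rewrite mul1r prod_nilpotent.
Qed.

End TrivialIdempotents.

(** * Reduction to trivial idempotents *)

Section Corner.
Variables (R : nzRingType) (e : R).
Hypotheses (e_idem : e * e = e) (e_central : forall x, e * x = x * e).
Hypothesis e_neq0 : e != 0.

Definition in_corner : pred R := fun x => e * x == x.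

Fact in_corner_zmod_closed : zmod_closed in_corner.
Proof.
split=> [|x y]; rewrite !unfold_in /in_corner ?mulr0 //.
by move=> /eqP ex /eqP ey; rewrite mulrBr ex ey.
Qed.
HB.instance Definition _ := GRing.isZmodClosed.Build R in_corner
  in_corner_zmod_closed.

(** The proofs are parameters of the type because its ring structure depends on
    them. *)
Definition corner (_ : e * e = e) (_ : forall x, e * x = x * e) (_ : e != 0) :=
  {x : R | in_corner x}.
Local Notation eR := (corner e_idem e_central e_neq0).
HB.instance Definition _ := SubChoice.on eR.
HB.instance Definition _ := [SubChoice_isSubZmodule of eR by <:].

Fact corner_mul_subproof (x y : eR) : in_corner (val x * val y).
Proof. by rewrite /in_corner mulrA (eqP (valP x)). Qed.
Definition corner_mul (x y : eR) : eR := Sub _ (corner_mul_subproof x y).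
Fact corner_one_subproof : in_corner e.
Proof. by rewrite /in_corner e_idem. Qed.
Definition corner_one : eR := Sub e corner_one_subproof.

Fact corner_mulA : associative corner_mul.
Proof. by move=> x y z; apply: val_inj; rewrite /= mulrA. Qed.
Fact corner_mul1 : left_id corner_one corner_mul.
Proof. by move=> x; apply: val_inj; rewrite /= (eqP (valP x)). Qed.
Fact corner_1mul : right_id corner_one corner_mul.
Proof. by move=> x; apply: val_inj; rewrite /= -e_central (eqP (valP x)). Qed.
Fact corner_mulDl : left_distributive corner_mul +%R.
Proof. by move=> x y z; apply: val_inj; exact: mulrDl. Qed.
Fact corner_mulDr : right_distributive corner_mul +%R.
Proof. by move=> x y z; apply: val_inj; exact: mulrDr. Qed.
Fact corner_one_neq0 : corner_one != 0.
Proof. by exact: e_neq0. Qed.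
HB.instance Definition _ := GRing.Zmodule_isNzRing.Build eR
  corner_mulA corner_mul1 corner_1mul corner_mulDl corner_mulDr corner_one_neq0.

End Corner.

(** A strictly decreasing sequence of idempotents cannot repeat a value. *)
Lemma minimal_central_idempotent (R : nzRingType) N (c : R) :
  abelian_ring R -> ~ (exists f : 'I_N -> R, injective f) -> c <> 0 ->
  exists e : R, [/\ e * e = e, e * c <> 0 &
    forall f : R, f * f = f -> e * f = f -> f * c <> 0 -> f = e].
Proof.
move=> abR small c0; apply: NNPP => noe.
have chain n : exists e s, [/\ e * e = e, e * c <> 0, uniq (e :: s),
    size s = n & {in s, forall g : R, g * e = e}].
  elim: n => [|n [e [s [ee ec us szs ge]]]].
    by exists 1, [::]; split; rewrite ?mul1r.
  have [f [ff ef fc fe]] : exists f : R, [/\ f * f = f, e * f = f, f * c <> 0 & f <> e].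
    apply: NNPP => H; apply: noe; exists e; split=> // f ff ef fc.
    by apply: NNPP => fe; apply: H; exists f.
  exists f, (e :: s); split=> //=; last 1 first.
  - move=> g; rewrite inE => /predU1P[->//|/ge gee].
    by rewrite -ef mulrA gee.
  - rewrite [_ && uniq s]us andbT inE negb_or; apply/andP; split; first exact/eqP.
    by apply/negP => /ge fee; apply: fe; rewrite -[RHS]fee -abR.
  by rewrite szs.
have [e [s [_ _ us szs _]]] := chain N.
apply: small; apply: (@at_least_injection _ (fun=> True)).
apply: (@leq_at_least _ _ _ N.+1) => //.
by exists (e :: s); split; rewrite //= szs.
Qed.

(** The corner ring at a minimal idempotent [e] with [e * (a * r * b) <> 0] has
    no idempotents besides 0 and 1: for an idempotent [x] of the corner, one of
    [x] and [e - x] does not kill [a * r * b], so it equals [e]. *)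
Theorem abelian_reflexive_order (R : nzRingType) :
  abelian_ring R -> reflexive_ring R -> ~ semicommutative_ring R ->
  exists f : 'I_256 -> R, injective f.
Proof.
move=> abR reflR nsemi; apply: NNPP => small; apply: nsemi => a b ab0 r.
apply: NNPP => arb0.
have [e [ee earb emin]] := minimal_central_idempotent abR small arb0.
have eC := abR e ee.
have e0 : e != 0 by apply/eqP => e0; apply: earb; rewrite e0 mul0r.
pose S := corner ee eC e0.
have smallS : ~ exists f : 'I_256 -> S, injective f.
  by case=> f injf; apply: small; exists (val \o f) => i j /val_inj/injf.
have idemS (x : S) : x * x = x -> x = 0 \/ x = 1.
  move/(congr1 val) => /= xx; have ex := eqP (valP x).
  case: (classic (val x * (a * r * b) = 0)) => [x0|xn0]; last first.
    by right; apply/val_inj/emin.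
  left; apply: val_inj => /=.
  have /emin : (e - val x) * (e - val x) = e - val x.
    by rewrite mulrBl !mulrBr ee ex -eC ex xx subrr subr0.
  rewrite mulrBr ee ex mulrBl x0 subr0 => /(_ erefl earb)/eqP.
  by rewrite subr_eq addrC -subr_eq subrr => /eqP.
have reflS : reflexive_ring S.
  move=> x y xSy s; apply: val_inj; apply: (reflR (val x) (val y)) => t.
  have et : in_corner e (e * t) by rewrite /in_corner mulrA ee.
  have /(congr1 val) /= := xSy (Sub _ et).
  by rewrite mulrA -eC (eqP (valP x)).
have proj (t : R) : in_corner e (e * t) by rewrite /in_corner mulrA ee.
pose p t : S := Sub _ (proj t).
have nilS : exists n, forall x : S, pow (@nilpotent_element S) n x -> x = 0.
  by exists 256 => x; apply: nilpotent_radical_pow.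
have semiS : semicommutative_ring S.
  apply: (semicommutative_small_local (nilpotent_local_radical smallS idemS)) => //.
  by move/at_least_injection.
have pM s t : p s * p t = p (s * t).
  by apply: val_inj; rewrite /= -mulrA (mulrA s) -(eC s) !mulrA ee.
have /semiS/(_ (p r)) : p a * p b = 0.
  by apply: val_inj; rewrite pM ab0 /= mulr0.
by rewrite !pM => /(congr1 val)/earb.
Qed.

(** * Group rings *)

Section GroupRingTheory.
Variables (R : comNzRingType) (gT : finGroupType).
Local Notation RG := (groupRing R gT).
Implicit Types f g : RG.

Definition group_elt (x : gT) : RG := [ffun y => (y == x)%:R].

Lemma group_elt_mul x f y : (group_elt x * f) y = f (x^-1 * y)%g.
Proof.
rewrite ffunE (bigD1 x) //= big1 => [|z nzx].
  by rewrite ffunE eqxx mul1r addr0.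
by rewrite ffunE (negPf nzx) mul0r.
Qed.

Lemma mul_group_elt x f y : (f * group_elt x) y = f (y * x^-1)%g.
Proof.
rewrite ffunE (bigD1 (y * x^-1)%g) //= big1 => [|z nzx].
  by rewrite ffunE invMg invgK mulgKV eqxx mulr1 addr0.
rewrite ffunE (_ : _ == _ = false) ?mulr0 //.
by apply: contra_neqF nzx => /eqP <-; rewrite invMg invgK mulKVg.
Qed.

Lemma group_eltM x y : group_elt x * group_elt y = group_elt (x * y)%g.
Proof.
apply/ffunP=> z; rewrite group_elt_mul !ffunE.
by rewrite -(inj_eq (mulgI x)) mulKVg.
Qed.

Lemma group_elt1 : group_elt 1%g = 1.
Proof. by apply/ffunP=> z; rewrite !ffunE. Qed.

(** The coefficient at the identity is a symmetric trace form; together with its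
    nondegeneracy this makes the group ring reflexive. *)
Lemma groupRing_trace f g : (f * g) 1%g = (g * f) 1%g.
Proof.
rewrite !ffunE (reindex_inj invg_inj) /=; apply: eq_bigr => x _.
by rewrite invgK !mulg1 mulrC.
Qed.

Lemma groupRing_reflexive : reflexive_ring RG.
Proof.
move=> a b aRb0 r; apply/ffunP=> x.
have -> : (b * r * a) x = (b * r * a * group_elt x^-1%g) 1%g.
  by rewrite mul_group_elt invgK mul1g.
by rewrite -mulrA groupRing_trace !mulrA aRb0 mul0r !ffunE.
Qed.

Definition augmentation f : R := \sum_x f x.

Lemma augmentationM f g : augmentation (f * g) = augmentation f * augmentation g.
Proof.
rewrite /augmentation; under eq_bigr do rewrite ffunE.
rewrite exchange_big mulr_suml; apply: eq_bigr => x _.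
by rewrite -mulr_sumr [in RHS](reindex_inj (mulgI x^-1%g)).
Qed.

Lemma augmentationB f g : augmentation (f - g) = augmentation f - augmentation g.
Proof. by rewrite /augmentation -sumrB; apply: eq_bigr => x _; rewrite !ffunE. Qed.

Lemma augmentation1 : augmentation 1 = 1.
Proof.
rewrite /augmentation (bigD1 1%g) //= big1 => [|x nx1]; rewrite ffunE ?eqxx ?addr0 //.
by rewrite (negPf nx1).
Qed.

(** A left invariant element has constant coefficients. *)
Lemma invariant_mul f g : (forall x, group_elt x * f = f) ->
  f * g = [ffun x => f x * augmentation g].
Proof.
move=> inv; apply/ffunP=> x; rewrite !ffunE mulr_sumr.
have const y z : f y = f z.
  by rewrite -{1}(inv (y * z^-1)%g) group_elt_mul invMg invgK mulgKV.
rewrite (reindex_inj invg_inj) [in RHS](reindex_inj (mulIg x)) /=.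
by apply: eq_bigr => y _; rewrite invgK (const _ x).
Qed.

Definition left_translate f x : RG := group_elt x^-1%g * f.

Fact left_translate_is_action : is_action [set: gT] left_translate.
Proof.
apply: is_total_action => [f|f x y].
  by rewrite /left_translate invg1 group_elt1 mul1r.
by rewrite /left_translate mulrA group_eltM invMg.
Qed.
Canonical left_translate_action := Action left_translate_is_action.

(** [(1 - s) * (1 + s) = 0], but [(1 - s) * t * (1 + s)] has coefficient 1 at
    [t]. *)
Lemma groupRing_nonsemicommutative (s t : gT) :
  (s * s = 1)%g -> (s * t != t * s)%g -> ~ semicommutative_ring RG.
Proof.
move=> ss st semi.
have ab0 : (1 - group_elt s) * (1 + group_elt s) = 0.
  by rewrite mulrDr mulr1 mulrBl mul1r group_eltM ss group_elt1 addrA subrK subrr.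
have /ffunP/(_ t) := semi _ _ ab0 (group_elt t).
have s1 : (s == 1)%g = false by apply: contraNF st => /eqP->; rewrite mulg1 mul1g.
have ts : (t == t * s)%g = false by rewrite -{1}[t]mulg1 (inj_eq (mulgI t)) eq_sym.
have st' : (t == s * t)%g = false by rewrite -{1}[t]mul1g (inj_eq (mulIg t)) eq_sym.
have sts : (t == s * t * s)%g = false.
  apply: contraNF st => /eqP {1}->.
  by rewrite -mulgA !mulgA ss mul1g.
rewrite mulrDr mulr1 !mulrBl !mul1r !group_eltM !ffunE eqxx ts st' sts.
by rewrite !subr0 addr0 => /eqP; rewrite oner_eq0.
Qed.

End GroupRingTheory.

Lemma card_additive_subgroup (V : finZmodType) (M : {set V}) :
  0 \in M -> {in M &, forall x y, x + y \in M} -> (#|M| %| #|V|)%N.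
Proof.
move=> M0 MD; have gM : group_set M by apply/group_setP.
by rewrite -cardsT (cardSg (subsetT (Group gM))).
Qed.

(** Replacing [e] by [1 - e], the augmentation of [e] is 0. The group acts by
    left translation on the left ideal [M] of the [y] with [y * e = y], and a
    fixed point [y] has constant coefficients, so [y = y * e = 0]. If [e] were
    not 0, the order of [M] would be a multiple of [p], whereas it is
    congruent to the number 1 of fixed points. *)
Lemma groupRing_pgroup_idempotents p (gT : finGroupType) :
  prime p -> (p.-group [set: gT])%g ->
  forall e : groupRing 'F_p gT, e * e = e -> e = 0 \/ e = 1.
Proof.
move=> p_pr pG.
suff H (e : groupRing 'F_p gT) : e * e = e -> augmentation e = 0 -> e = 0.
  move=> e ee; have := congr1 (@augmentation _ _) ee; rewrite augmentationM.
  move/eqP; rewrite -subr_eq0 -{3}[augmentation e]mulr1 -mulrBr mulf_eq0 subr_eq0.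
  case/orP=> /eqP ae; [left|right]; first exact: H.
  apply/esym/eqP; rewrite -subr_eq0; apply/eqP/H.
    by rewrite mulrBl !mulrBr ee !(mul1r, mulr1) subrr subr0.
  by rewrite augmentationB augmentation1 ae subrr.
move=> ee ae0; pose M : {set groupRing 'F_p gT} := [set y | y * e == y].
have actM : [acts [set: gT], on M | left_translate_action 'F_p gT]%g.
  apply/actsP => x _ y; rewrite !inE /= /left_translate -mulrA.
  apply: inj_eq => f g /(congr1 (fun h => group_elt _ x * h)).
  by rewrite !mulrA !group_eltM mulgV group_elt1 !mul1r.
apply/eqP; apply: contraT => e0.
have fixM : 'Fix_(M | left_translate_action 'F_p gT)([set: gT])%g = [set 0].
  apply/setP => f; rewrite in_setI in_set1 [f \in M]inE; apply/idP/eqP => [/andP[/eqP fe /afixP fixf]|->].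
    have inv x : group_elt _ x * f = f.
      by have := fixf x^-1%g (in_setT _); rewrite /= /left_translate invgK.
    by rewrite -fe invariant_mul //; apply/ffunP=> x; rewrite ae0 !ffunE mulr0.
  rewrite mul0r eqxx; apply/afixP => x _.
  by rewrite /= /left_translate mulr0.
have := pgroup_fix_mod pG actM; rewrite fixM cards1 => cardM.
have : (#|M| %| p ^ #|gT|)%N.
  have <- : #|{: groupRing 'F_p gT}| = (p ^ #|gT|)%N by rewrite card_ffun card_Fp.
  apply: (@card_additive_subgroup (groupRing 'F_p gT)); rewrite ?inE ?mul0r //.
  by move=> x y; rewrite !inE mulrDl => /eqP-> /eqP->.
case/(dvdn_pfactor _ _ p_pr) => -[|m] _ cM.
  have /subsetP/(_ e) : M \subset [set 0].
    by rewrite (_ : [set 0] = M) //; apply/eqP; rewrite eqEcard sub1set inE mul0r eqxx cM cards1.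
  by rewrite !inE ee eqxx (negPf e0) => /(_ isT).
by move: cardM; rewrite cM expnS modnMr modn_small // prime_gt1.
Qed.

Lemma groupRing_pgroup_abelian p (gT : finGroupType) :
  prime p -> (p.-group [set: gT])%g -> abelian_ring (groupRing 'F_p gT).
Proof.
move=> p_pr pG e /(groupRing_pgroup_idempotents p_pr pG)[]-> x.
  by rewrite mul0r mulr0.
by rewrite mul1r mulr1.
Qed.

Theorem theorem2 :
  (forall R : nzRingType,
     abelian_ring R -> reflexive_ring R -> ~ semicommutative_ring R ->
     exists f : 'I_256 -> R, injective f) /\
  [/\ abelian_ring (groupRing 'F_2 'D_8),
      reflexive_ring (groupRing 'F_2 'D_8),
      ~ semicommutative_ring (groupRing 'F_2 'D_8) &
      #|{: groupRing 'F_2 'D_8}| = 256%N].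
Proof.
have oD : #|[set: 'D_8]| = 8%N := card_2dihedral (isT : 1 < 3)%N.
split; first exact: abelian_reflexive_order.
split.
- by apply: groupRing_pgroup_abelian => //; rewrite /pgroup oD.
- exact: groupRing_reflexive.
- have [[x y] [_ _ ox _] [oy xy]] := generators_2dihedral (isT : 1 < 3)%N (isog_refl [set: 'D_8]%G).
  apply: (@groupRing_nonsemicommutative _ _ y x).
    by rewrite -(expg_order y) oy.
  apply/eqP => yx; have : (x ^+ 2 = 1)%g.
    by rewrite expgS expg1 -{1}[x]invgK -xy conjgE -yx mulKg mulVg.
  by move/eqP; rewrite -order_dvdn ox.
by rewrite card_ffun card_Fp // -cardsT oD.
Qed.
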